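(* Let $v\in\{0,1\}^*$ and $x\in\{0,1\}$. In order to get $\Gamma_{xv}$ one has to replace in $\Gamma_v$ each vertex $w$ by a pair of vertices $0w$ and $1w$ connected by an edge labeled by $\alpha$, connect $(1-x)w$ to $(1-x)\alpha(w)$ by an edge labeled by $\beta$, and connect $0w$ to $0\gamma(w)$ and $1w$ to $1\beta(w)$ by edges labeled by $\gamma$ (for all $w\in E_v$, where $\alpha,\beta,\gamma$ act on $E_v$, and loops are ignored).
   Context: For an infinite binary sequence $w=x_1x_2\ldots\in\{0,1\}^\omega$ with shift $\overline w=x_2x_3\ldots$, define automorphisms $\alpha_w,\beta_w,\gamma_w$ of the binary tree $\{0,1\}^*$ recursively by: $\alpha_w(0s)=1s$, $\alpha_w(1s)=0s$; $\gamma_w(0s)=0\gamma_{\overline w}(s)$, $\gamma_w(1s)=1\beta_{\overline w}(s)$; if $x_1=0$ then $\beta_w(0s)=0s$, $\beta_w(1s)=1\alpha_{\overline w}(s)$; if $x_1=1$ then $\beta_w(0s)=0\alpha_{\overline w}(s)$, $\beta_w(1s)=1s$. For $v\in\{0,1\}^n$ the action of $\alpha_w,\beta_w,\gamma_w$ on $\{0,1\}^n$ depends only on the prefix $v$ of $w$; it is denoted $\alpha,\beta,\gamma$, and the set $\{0,1\}^n$ with this action is denoted $E_v$. $\Gamma_v$ is the simplicial (loops are ignored) Schreier graph with vertex set $E_v$ in which $s_1\neq s_2$ are adjacent iff $g(s_1)=s_2$ for some $g\in\{\alpha,\beta,\gamma\}$; the edge is labeled by $g$. *)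

(* Defs.v *)
From mathcomp Require Import all_boot.

Set Implicit Arguments.
Unset Strict Implicit.
Unset Printing Implicit Defensive.

(* The letters 0 and 1 are [false] and [true]; an infinite word x_1 x_2 ... is
   a function on [nat] whose value at [0] is x_1. *)
Definition oword := nat -> bool.

Definition shift (w : oword) : oword := fun i => w i.+1.

Definition alpha (w : oword) (s : seq bool) : seq bool :=
  match s with
  | [::] => [::]
  | false :: s' => true :: s'
  | true :: s' => false :: s'
  end.

Definition beta (w : oword) (s : seq bool) : seq bool :=
  match w 0, s with
  | _, [::] => [::]
  | false, false :: s' => false :: s'
  | false, true :: s' => true :: alpha (shift w) s'
  | true, false :: s' => false :: alpha (shift w) s'
  | true, true :: s' => true :: s'
  end.

Fixpoint gamma (w : oword) (s : seq bool) : seq bool :=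
  match s with
  | [::] => [::]
  | false :: s' => false :: gamma (shift w) s'
  | true :: s' => true :: beta (shift w) s'
  end.

Inductive gen := Alpha | Beta | Gamma.

Definition aut (w : oword) (g : gen) : seq bool -> seq bool :=
  match g with Alpha => alpha w | Beta => beta w | Gamma => gamma w end.

Lemma size_alpha w s : size (alpha w s) = size s.
Proof. by case: s => [|[] s]. Qed.

Lemma size_beta w s : size (beta w s) = size s.
Proof. by rewrite /beta; case: (w 0); case: s => [|[] s] //=; rewrite size_alpha. Qed.

Lemma size_gamma w s : size (gamma w s) = size s.
Proof. by elim: s w => [|[] s IHs] w //=; rewrite ?size_beta ?IHs. Qed.

Lemma size_aut w g s : size (aut w g s) = size s.
Proof. by case: g; rewrite /= ?size_alpha ?size_beta ?size_gamma. Qed.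

Lemma alphaK w : involutive (alpha w).
Proof. by case=> [|[] s]. Qed.

Lemma betaK w : involutive (beta w).
Proof.
by move=> s; rewrite /beta; case: (w 0); case: s => [|[] s] //=; rewrite alphaK.
Qed.

Lemma gammaK w : involutive (gamma w).
Proof. by move=> s; elim: s w => [|[] s IHs] w //=; rewrite ?betaK ?IHs. Qed.

Lemma autK w g : involutive (aut w g).
Proof. by case: g; [apply: alphaK | apply: betaK | apply: gammaK]. Qed.

Lemma alpha_take w n s : alpha w (take n s) = take n (alpha w s).
Proof. by case: n s => [|n] [|[] s]. Qed.

Lemma beta_take w n s : beta w (take n s) = take n (beta w s).
Proof.
rewrite /beta; case: n s => [|n] [|[] s] //=; case: (w 0) => //=.
  by rewrite alpha_take.
by rewrite alpha_take.
Qed.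

(* Together with [size_aut] and [autK]: each [aut w g] is an automorphism of
   the rooted binary tree. *)
Lemma aut_take w g n s : aut w g (take n s) = take n (aut w g s).
Proof.
case: g => /=; [exact: alpha_take | exact: beta_take |].
elim: n s w => [|n IHn] [|[] s] w //=; first by rewrite beta_take.
by rewrite IHn.
Qed.

Lemma aut_prefix (w w' : oword) g s :
  (forall i, i < size s -> w i = w' i) -> aut w g s = aut w' g s.
Proof.
have beta_prefix u u' t : (forall i, i < size t -> u i = u' i) ->
    beta u t = beta u' t.
  by rewrite /beta; case: t => [|b t] eq_u; [case: (u 0); case: (u' 0) |
    rewrite eq_u].
case: g => //=; first exact: beta_prefix.
elim: s w w' => [|[] s IHs] w w' eq_w //=; congr (_ :: _).
  by apply: beta_prefix => i lt_i; apply: eq_w.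
by apply: IHs => i lt_i; apply: eq_w.
Qed.

Definition E (v : seq bool) : Type := (size v).-tuple bool.

(* An arbitrary infinite word with prefix [v]; by [val_act] the padding is
   irrelevant for the action on [E v]. *)
Definition pad (v : seq bool) : oword := nth false v.

Lemma act_subproof v g (s : E v) : size (aut (pad v) g s) == size v.
Proof. by rewrite size_aut size_tuple. Qed.

Definition act v (g : gen) (s : E v) : E v := Tuple (act_subproof g s).

Lemma val_act v (w : oword) g (s : E v) :
  (forall i, i < size v -> w i = nth false v i) ->
  val (act g s) = aut w g s.
Proof.
by move=> eq_w; apply: aut_prefix => i; rewrite size_tuple => /eq_w.
Qed.

Lemma actK v g : involutive (@act v g).
Proof. by move=> s; apply: val_inj; apply: autK. Qed.

(* Simplicial graph with labeled edges: [lab g s t] says that [s] and [t] are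
   joined by an edge that carries the label [g]. *)
Record lgraph (V : Type) := LGraph {
  lab : gen -> V -> V -> Prop;
  lab_sym : forall g s t, lab g s t -> lab g t s;
  lab_irr : forall g s, ~ lab g s s
}.

Definition adj V (G : lgraph V) (s t : V) : Prop := exists g, lab G g s t.

Definition lgraph_iso V1 V2 (G1 : lgraph V1) (G2 : lgraph V2) (f : V1 -> V2) :=
  [/\ bijective f,
      forall s t, adj G1 s t <-> adj G2 (f s) (f t)
    & forall g s t, lab G1 g s t <-> lab G2 g (f s) (f t)].

Definition schreier_lab v (g : gen) (s1 s2 : E v) : Prop :=
  s1 <> s2 /\ act g s1 = s2.

Lemma schreier_sym v g (s t : E v) : schreier_lab g s t -> schreier_lab g t s.
Proof. by case=> neq_st eq_t; split; [exact: nesym | rewrite -eq_t actK]. Qed.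

Lemma schreier_irr v g (s : E v) : ~ schreier_lab g s s.
Proof. by case. Qed.

(* Each edge of the Schreier graph carries exactly one label. *)
Lemma schreier_lab_inj v g h (s t : E v) :
  schreier_lab g s t -> schreier_lab h s t -> g = h.
Proof.
have alpha_fix w r : beta w r = alpha w r \/ gamma w r = alpha w r -> r = [::].
  by case: r => [|[] r] //; rewrite /beta; case: (w 0) => -[].
have beta_gamma w r : beta w r = gamma w r -> beta w r = r.
  case: r => [|b r]; rewrite /beta; first by case: (w 0).
  case: (w 0); case: b => //= -[e].
    by rewrite (alpha_fix (shift w) r) //; right.
  by rewrite (alpha_fix (shift w) r) //; left.
case=> neq_st gst [_ hst].
have nil_eq : val s = [::] -> False.
  move=> s0; apply: neq_st; apply: val_inj; rewrite s0; apply/esym/size0nil.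
  by rewrite size_tuple -(size_tuple s) s0.
have neq u : val u = val s -> u = t -> False.
  by move=> /val_inj -> /neq_st.
have: aut (pad v) g s = aut (pad v) h s by rewrite -[LHS]/(val (act g s)) gst -hst.
case: g h gst hst neq => [] [] //= gst hst neq e; exfalso.
- by apply/nil_eq/(alpha_fix (pad v)); left.
- by apply/nil_eq/(alpha_fix (pad v)); right.
- by apply/nil_eq/(alpha_fix (pad v)); left.
- by apply: (neq (act Beta s)) => //=; apply: beta_gamma.
- by apply/nil_eq/(alpha_fix (pad v)); right.
- by apply: (neq (act Beta s)); rewrite /= ?gst -?hst //; apply: beta_gamma.
Qed.

Definition schreier v : lgraph (E v) :=
  LGraph (@schreier_sym v) (@schreier_irr v).

Section LinkGraph.
Variables (V : Type) (c : gen -> V -> V -> Prop).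

Definition link_lab g s t := s <> t /\ (c g s t \/ c g t s).

Lemma link_sym g s t : link_lab g s t -> link_lab g t s.
Proof. by case=> neq_st c_st; split; [exact: nesym | case: c_st; [right | left]]. Qed.

Lemma link_irr g s : ~ link_lab g s s.
Proof. by case. Qed.

(* The graph obtained by joining the pairs in [c], ignoring loops. *)
Definition link_graph : lgraph V := LGraph link_sym link_irr.

End LinkGraph.

(* The pair [(i, w)] stands for the new vertex [iw]. *)
Inductive replace_link (x : bool) (v : seq bool) :
    gen -> bool * E v -> bool * E v -> Prop :=
  | link_alpha w : replace_link x Alpha (false, w) (true, w)
  | link_beta w : replace_link x Beta (~~ x, w) (~~ x, act Alpha w)
  | link_gamma0 w : replace_link x Gamma (false, w) (false, act Gamma w)
  | link_gamma1 w : replace_link x Gamma (true, w) (true, act Beta w).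

Definition replaced x v : lgraph (bool * E v) :=
  link_graph (@replace_link x v).

Definition prepend x v (p : bool * E v) : E (x :: v) := cons_tuple p.1 p.2.

(* Main.v *)
Require Import Defs.
From mathcomp Require Import all_boot.

(** The first letter splits the vertices of the graph of [x :: v] into pairs
    [0w], [1w], and the recursive definition of the three automorphisms says
    how each generator acts on a pair [(i, w)] in terms of the action of [v] on
    [w]; this is the map [step] below, and [act_prepend] states that [prepend]
    turns it into the action on the longer words.  An edge labeled [g] of the
    new graph is thus a non-loop [p], [step g p].  The construction of the
    statement lists the same pairs, with two differences that cancel out: it
    lists the [Alpha]-edges in one direction only, which is harmless because
    the generators are involutions, and it lists nothing for [Beta] at the
    vertices [xw], which are fixed by [Beta] and hence only carry loops.  So
    labels, and with them adjacency, agree through the bijection [prepend]. *)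

(** The self-similar recursion of the generators, read on pairs (first letter,
    remaining word).  The section of [Beta] is nontrivial only below the letter
    [~~ x]. *)
Definition step (x : bool) (v : seq bool) (g : gen) (p : bool * E v) :
    bool * E v :=
  match g with
  | Alpha => (~~ p.1, p.2)
  | Beta => (p.1, if p.1 == ~~ x then act Alpha p.2 else p.2)
  | Gamma => (p.1, act (if p.1 then Beta else Gamma) p.2)
  end.

Lemma act_prepend x v g (p : bool * E v) :
  act g (prepend x p) = prepend x (step x v g p).
Proof. by apply: val_inj; case: g x p => -[] [[] w]. Qed.

Lemma prepend_bij x v : bijective (@prepend x v).
Proof.
exists (fun t : E (x :: v) => (thead t, behead_tuple t)) => [[i w] | t].
  by congr (_, _); apply: val_inj.
by rewrite /prepend /= [RHS]tuple_eta; apply: val_inj.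
Qed.

Lemma step_involutive x v g : involutive (step x v g).
Proof.
move=> p; apply: (bij_inj (prepend_bij x v)).
by rewrite -!act_prepend actK.
Qed.

Lemma replace_link_step x v g p q :
  replace_link x (v := v) g p q -> step x v g p = q.
Proof. by case=> w //=; rewrite eqxx. Qed.

(** The listed pairs count in both directions, which is sound because [step] is
    an involution, and needed because [Alpha] is listed only from [0w] to
    [1w]. *)
Lemma replaced_labE x v g (p q : bool * E v) :
  lab (replaced x v) g p q <-> p <> q /\ step x v g p = q.
Proof.
split=> -[neq_pq].
  by case=> /replace_link_step eq_pq; split=> //; rewrite -eq_pq step_involutive.
move=> eq_q; split=> //; move: neq_pq; rewrite -{}eq_q.
case: g p => -[i w] /=.
- by case: i => _; [right | left]; constructor.
- (* away from the letter [~~ x] the pair is a loop, excluded by hypothesis *)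
  by case: eqP => [-> _ | _ []] //; left; constructor.
- by case: i => _; left; constructor.
Qed.

Lemma lab_prepend x v g (p q : bool * E v) :
  lab (replaced x v) g p q
    <-> lab (schreier (x :: v)) g (prepend x p) (prepend x q).
Proof.
have inj := bij_inj (prepend_bij x v).
apply: iff_trans (replaced_labE x v g p q) _.
rewrite /= /schreier_lab act_prepend.
split=> -[neq_pq eq_q]; split; first by move/inj.
- by rewrite eq_q.
- by move=> eq_pq; apply: neq_pq; rewrite eq_pq.
- exact: inj.
Qed.

Theorem corollary3p12 (v : seq bool) (x : bool) :
  lgraph_iso (replaced x v) (schreier (x :: v)) (@prepend x v).
Proof.
split; [exact: prepend_bij | | by move=> g p q; apply: lab_prepend].
by move=> p q; split=> -[g] /lab_prepend lab_g; exists g.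
Qed.
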